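(* For every fixed integer $k\ge 2$ and every fixed $\epsilon>0$ there is a polynomial-time algorithm that, given any $k$-ary string $s$, computes a sequence of prefix reversals transforming $s$ into its sorted rearrangement $I(s)$ using at most $(1+\epsilon)\,d_{\rm s}(s)$ prefix reversals, where $d_{\rm s}(s)$ is the minimum possible number.
   Context: A $k$-ary string is a finite word over $\{0,1,\dots,k-1\}$. The prefix reversal (flip) $f^{(i)}$ applied to $s=s_1\cdots s_n$ ($1\le i\le n$) yields $s_i s_{i-1}\cdots s_1 s_{i+1}\cdots s_n$. $I(s)$ denotes the string obtained by sorting the symbols of $s$ in non-decreasing order, and $d_{\rm s}(s)$ is the minimum number of prefix reversals transforming $s$ into $I(s)$. *)

(* Defs.v *)
From HB Require Import structures.
From mathcomp Require Import all_boot all_order all_algebra.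
From mathcomp Require Import boolp reals.
Set Implicit Arguments. Unset Strict Implicit. Unset Printing Implicit Defensive.
Import Order.TTheory GRing.Theory Num.Theory.

Definition flip {T : Type} (i : nat) (s : seq T) : seq T :=
  rev (take i s) ++ drop i s.

Definition apply_flips {T : Type} (fl : seq nat) (s : seq T) : seq T :=
  foldl (fun t i => flip i t) s fl.

Definition valid_flips {T : Type} (s : seq T) (fl : seq nat) : bool :=
  all (fun i => (0 < i <= size s)%N) fl.

Definition I_sort (k : nat) (s : seq 'I_k) : seq 'I_k :=
  sort (fun a b : 'I_k => (a <= b)%N) s.

Fixpoint sortable_in (k : nat) (m : nat) (t : seq 'I_k) (target : seq 'I_k)
  : bool :=
  if m is m'.+1 then
    has (fun i => sortable_in m' (flip i t) target) (iota 1 (size t))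
  else t == target.

Definition sortable_in_steps (k : nat) (s : seq 'I_k) (m : nat) : bool :=
  sortable_in m s (I_sort s).

(* d_s(s): the minimum number of prefix reversals transforming s into I(s)
   (defined as 0 if no such sequence existed, which never happens). *)
Definition d_s (k : nat) (s : seq 'I_k) : nat :=
  match pselect (exists m, sortable_in_steps s m) with
  | left H => ex_minn H
  | right _ => 0%N
  end.

Inductive move := MoveL | MoveR | Stay.

(* States 'I_(nQ.+1) with start state 0; tape symbols 'I_(nG.+1) with blank 0.
   The machine halts when delta is undefined (None). *)
Record TM := {
  tm_nQ : nat;
  tm_nG : nat;
  tm_delta : 'I_tm_nQ.+1 -> 'I_tm_nG.+1 -> option ('I_tm_nQ.+1 * 'I_tm_nG.+1 * move)
}.

Definition sym (M : TM) := 'I_(tm_nG M).+1.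

(* configuration: state, left part of tape (reversed, nearest cell first),
   scanned symbol, right part of tape *)
Definition config (M : TM) := ('I_(tm_nQ M).+1 * seq (sym M) * sym M * seq (sym M))%type.

Definition step (M : TM) (c : config M) : option (config M) :=
  let: (q, l, a, r) := c in
  match @tm_delta M q a with
  | None => None
  | Some (q', b, mv) =>
      Some match mv with
      | Stay => (q', l, b, r)
      | MoveL => (q', behead l, head ord0 l, b :: r)
      | MoveR => (q', b :: l, head ord0 r, behead r)
      end
  end.

Fixpoint run (M : TM) (T : nat) (c : config M) : option (config M) :=
  match step c with
  | None => Some c
  | Some c' => if T is T'.+1 then run T' c' else None
  end.

Definition init (M : TM) (w : seq (sym M)) : config M :=
  (ord0, [::], head ord0 w, behead w).

Definition output (M : TM) (c : config M) : seq nat :=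
  let: (_, _, a, r) := c in
  let t := [seq val x | x <- a :: r] in
  take (find (fun x => x == 0%N) t) t.

(* Input encoding of a k-ary string: symbol a is written as tape symbol a+3
   (0 = blank, 1 and 2 are reserved for the output). *)
Definition encode_input (k : nat) (M : TM) (s : seq 'I_k) : seq (sym M) :=
  [seq inord (val a + 3) | a <- s].

(* Output encoding of a flip sequence [i_1; ...; i_m]:
   1^{i_1} 2 1^{i_2} 2 ... 1^{i_m} 2  (unary, separator 2). *)
Fixpoint decode_aux (cnt : nat) (w : seq nat) : option (seq nat) :=
  match w with
  | [::] => if cnt == 0%N then Some [::] else None
  | 1%N :: w' => decode_aux cnt.+1 w'
  | 2%N :: w' => omap (cons cnt) (decode_aux 0 w')
  | _ => None
  end.

Definition decode_flips (w : seq nat) : option (seq nat) := decode_aux 0 w.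

Definition tm_outputs (k : nat) (M : TM) (T : nat) (s : seq 'I_k) (fl : seq nat)
  : Prop :=
  exists c : config M, run T (init (encode_input M s)) = Some c /\
            decode_flips (output c) = Some fl.

(* Main.v *)
Require Import Defs.
From HB Require Import structures.
From mathcomp Require Import all_boot all_order all_algebra.
From mathcomp Require Import boolp reals.
From mathcomp Require Import zify.
Import Order.TTheory GRing.Theory Num.Theory.
Set Implicit Arguments. Unset Strict Implicit. Unset Printing Implicit Defensive.

(** A flip lowers the number of runs (maximal constant blocks) by at most one
    and a sorted string has at most [k] runs, so [d_s s >= runs s - k].
    Conversely, if the first symbol recurs in a later run, flipping the prefix
    just before that run merges two runs; otherwise flipping the whole string
    puts the first symbol at the end, where it is frozen and excluded from later
    flips.  After at most [k] such wasted flips at most [k] runs remain, which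
    cost a constant depending only on [k]: greedy sorting is optimal up to an
    additive constant, hence up to [1 + eps] once there are more than some [N]
    runs.  With at most [N] runs, [d_s] is monotone under taking subsequences, so
    [s] and its string of runs have the same distance, and an optimal flip can
    be read off a finite table indexed by strings of at most [N] runs.

    Both strategies are run by a finite controller that scans the string from
    left to right and decides where to flip.  A one-tape machine simulates such
    a controller: scanned symbols are marked, and a flip carries the marked
    symbols one by one to the left end of the tape, leaving gaps, while adding a
    1 to the output on the right for each of them. *)

(** * Controllers and their simulation by a Turing machine *)

Inductive action (Q : Type) := Cont of Q | Flip of Q | Rewind of Q | Halt.
Arguments Halt {Q}.

Definition controller (k : nat) (Q : Type) := Q -> option 'I_k -> action Q.

(* [(q, u, v)]: control state, scanned prefix, rest of the string; reading past
   the end of the string yields [None]. *)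
Definition cconf (k : nat) (Q : Type) := (Q * seq 'I_k * seq 'I_k)%type.

Definition cstep k Q (d : controller k Q) (c : cconf k Q) :
    option (seq nat * cconf k Q) :=
  let: (q, u, v) := c in
  match d q (ohead v) with
  | Cont q' => Some ([::], if v is y :: v' then (q', rcons u y, v') else (q', u, v))
  | Flip q' => Some ([:: size u], (q', [::], rev u ++ v))
  | Rewind q' => Some ([::], (q', [::], u ++ v))
  | Halt => None
  end.

Fixpoint csteps k Q (d : controller k Q) (T : nat) (c : cconf k Q)
    (fl : seq nat) (c' : cconf k Q) : Prop :=
  if T is T'.+1 then
    exists fl1 c1 fl2, [/\ cstep d c = Some (fl1, c1), csteps d T' c1 fl2 c' & fl = fl1 ++ fl2]
  else fl = [::] /\ c = c'.

Section Simulation.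
Variables (k : nat) (Q : finType) (q0 : Q) (d : controller k Q).

(* [Un] marks unscanned and [Pr] scanned symbols of the string, where [None] is
   a gap left behind by a moved symbol; [Out false] and [Out true] are the
   output symbols 1 and 2. *)
Inductive cell := Bk | Out of bool | Un of option 'I_k | Pr of option 'I_k.

Inductive ctl :=
  | Scan of Q | Find of Q | Carry of Q & 'I_k | App of Q | Back of Q | Home of Q.

(** Only transports the finite type structure from a sum type to [ctl], so that states can be
    numbered. *)
Definition ctl_sum (p : ctl) : Q + (Q + (Q * 'I_k + (Q + (Q + Q)))) :=
  match p with
  | Scan q => inl q
  | Find q => inr (inl q)
  | Carry q a => inr (inr (inl (q, a)))
  | App q => inr (inr (inr (inl q)))
  | Back q => inr (inr (inr (inr (inl q))))
  | Home q => inr (inr (inr (inr (inr q))))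
  end.

Definition sum_ctl (x : Q + (Q + (Q * 'I_k + (Q + (Q + Q))))) : ctl :=
  match x with
  | inl q => Scan q
  | inr (inl q) => Find q
  | inr (inr (inl (q, a))) => Carry q a
  | inr (inr (inr (inl q))) => App q
  | inr (inr (inr (inr (inl q)))) => Back q
  | inr (inr (inr (inr (inr q)))) => Home q
  end.

Lemma ctl_sumK : cancel ctl_sum sum_ctl.
Proof. by case. Qed.

HB.instance Definition _ := Finite.copy ctl (can_type ctl_sumK).

(** [Scan] simulates the controller. A flip loops through [Back] (to the left end), [Find] (next
    scanned symbol), [Carry] (to the left end) and [App] (write a 1 after the output). When [Find]
    reaches the blank after the output, it writes the separator and [Home] unmarks the tape. Each
    symbol is put in front of those carried before it, which reverses the prefix. *)
Definition delta (p : ctl) (x : cell) : option (ctl * cell * move) :=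
  let decide o y right stay :=
    match d stay o with
    | Cont q' => Some (Scan q', y, right)
    | Flip q' => Some (Back q', x, MoveL)
    | Rewind q' => Some (Home q', x, MoveL)
    | Halt => None
    end in
  match p, x with
  | Scan q, Un None => Some (Scan q, Pr None, MoveR)
  | Scan q, Un (Some a) => decide (Some a) (Pr (Some a)) MoveR q
  | Scan q, Pr _ => None
  | Scan q, _ => decide None x Stay q
  | Back q, Bk => Some (Find q, Bk, MoveR)
  | Back q, _ => Some (Back q, x, MoveL)
  | Find q, Un _ => Some (Find q, x, MoveR)
  | Find q, Pr None => Some (Find q, Un None, MoveR)
  | Find q, Pr (Some a) => Some (Carry q a, Un None, MoveL)
  | Find q, Out _ => Some (Find q, x, MoveR)
  | Find q, Bk => Some (Home q, Out true, MoveL)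
  | Carry q a, Bk => Some (App q, Un (Some a), MoveR)
  | Carry q a, _ => Some (Carry q a, x, MoveL)
  | App q, Bk => Some (Back q, Out false, MoveL)
  | App q, _ => Some (App q, x, MoveR)
  | Home q, Bk => Some (Scan q, Bk, MoveR)
  | Home q, Pr o => Some (Home q, Un o, MoveL)
  | Home q, _ => Some (Home q, x, MoveL)
  end.

Definition tape := (ctl * seq cell * seq cell)%type.

(** Cells beyond the list are blank; [norm] makes the first of them explicit, as happens when the
    head visits it. *)
Definition norm (r : seq cell) := head Bk r :: behead r.

Definition left_of p (l r : seq cell) : tape := (p, behead l, head Bk l :: r).

Definition tstep (c : tape) : option tape :=
  let: (p, l, r) := c in
  match delta p (head Bk r) with
  | None => None
  | Some (p', b, mv) =>
      Some match mv with
      | Stay => (p', l, b :: behead r)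
      | MoveL => left_of p' l (b :: behead r)
      | MoveR => (p', b :: l, behead r)
      end
  end.

Fixpoint titer n (c : tape) : option tape :=
  if n is n'.+1 then obind (titer n') (tstep c) else Some c.

Definition reach (B : nat) (c c' : tape) : Prop :=
  exists2 n, n <= B & titer n c = Some c'.

Lemma titerD m n c : titer (m + n) c = obind (titer n) (titer m c).
Proof. by elim: m c => //= m IH c; case: (tstep c) => //=. Qed.

Lemma reach0 c : reach 0 c c.
Proof. by exists 0. Qed.

Lemma reach1 c c' : tstep c = Some c' -> reach 1 c c'.
Proof. by move=> e; exists 1 => //=; rewrite e. Qed.

Lemma reach_trans B1 B2 c1 c2 c3 :
  reach B1 c1 c2 -> reach B2 c2 c3 -> reach (B1 + B2) c1 c3.
Proof.
move=> [m lem e1] [n len e2]; exists (m + n); first exact: leq_add.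
by rewrite titerD e1.
Qed.

Lemma reach_le B1 B2 c1 c2 : B1 <= B2 -> reach B1 c1 c2 -> reach B2 c1 c2.
Proof. by move=> le [n len e]; exists n => //; apply: leq_trans len le. Qed.

Lemma reach_right p (P : pred cell) l w r :
    (forall x, P x -> delta p x = Some (p, x, MoveR)) -> all P w ->
  reach (size w) (p, l, w ++ r) (p, rev w ++ l, r).
Proof.
move=> dP; elim: w l => [|x w IH] l /=; first by move=> _; exact: reach0.
case/andP=> Px Pw; rewrite -add1n; apply: reach_trans.
  by apply: reach1; rewrite /= dP.
by rewrite rev_cons cat_rcons; exact: IH.
Qed.

Lemma reach_left p (P : pred cell) f l w r :
    (forall x, P x -> delta p x = Some (p, f x, MoveL)) -> all P w ->
  reach (size w) (left_of p (w ++ l) r) (left_of p l (rev (map f w) ++ r)).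
Proof.
move=> dP; elim: w r => [|x w IH] r /=; first by move=> _; exact: reach0.
case/andP=> Px Pw; rewrite -add1n; apply: reach_trans.
  by apply: reach1; rewrite /= dP.
by rewrite rev_cons cat_rcons; exact: IH.
Qed.

Definition isBk x := if x is Bk then true else false.
Definition isUO x := match x with Un _ | Out _ => true | _ => false end.
Definition nonBk x := ~~ isBk x.

Lemma blank_head l : all isBk l -> head Bk l = Bk.
Proof. by case: l => [|[]]. Qed.

Lemma blank_behead l : all isBk l -> all isBk (behead l).
Proof. by case: l => //= x l /andP[]. Qed.

Lemma isUO_Un w : all isUO (map Un w).
Proof. by elim: w. Qed.

Lemma isUO_Out o : all isUO (map Out o).
Proof. by elim: o. Qed.

Lemma nonBk_Un w : all nonBk (map Un w).
Proof. by elim: w. Qed.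

Lemma nonBk_Pr w : all nonBk (map Pr w).
Proof. by elim: w. Qed.

Lemma nonBk_Out o : all nonBk (map Out o).
Proof. by elim: o. Qed.

Definition nonBkE := (all_cat, all_rev, nonBk_Un, nonBk_Pr, nonBk_Out).
Definition sizeE := (size_rev, size_map, size_cat, size_rcons, size_nseq).

(** Making the scanned cell explicit can only change the blank padding behind the output. *)
Lemma norm_blank V o z : all isBk z ->
  exists2 z', all isBk z' & norm (map Un V ++ map Out o ++ z) = map Un V ++ map Out o ++ z'.
Proof.
case: V => [|x V] bz; last by exists z.
case: o => [|x o]; last by exists z.
by exists (norm z) => //=; rewrite blank_head //= blank_behead.
Qed.

Lemma reach_back q l w r : all isBk l -> all nonBk w ->
  reach (size w).+1 (left_of (Back q) (w ++ l) r) (Find q, norm l, rev w ++ r).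
Proof.
move=> bl nw; rewrite -addn1; apply: reach_trans.
  by apply: (@reach_left _ nonBk id) nw => -[].
by rewrite map_id; apply: reach1; rewrite /= blank_head // /norm blank_head.
Qed.

Definition unprime x := if x is Pr o then Un o else x.

Lemma reach_home q l w r : all isBk l -> all nonBk w ->
  reach (size w).+1 (left_of (Home q) (w ++ l) r)
    (Scan q, norm l, rev (map unprime w) ++ r).
Proof.
move=> bl nw; rewrite -addn1; apply: reach_trans.
  by apply: (@reach_left _ nonBk unprime) nw => -[].
by apply: reach1; rewrite /= blank_head // /norm blank_head.
Qed.

Lemma norm_blankP l : all isBk l -> all isBk (norm l).
Proof. by move=> bl; rewrite /= blank_head // blank_behead. Qed.

Lemma unprime_Un w : map unprime (map Un w) = map Un w.
Proof. by rewrite -map_comp. Qed.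

Lemma unprime_Pr w : map unprime (map Pr w) = map Un w.
Proof. by rewrite -map_comp. Qed.

Lemma unprime_Out o : map unprime (map Out o) = map Out o.
Proof. by rewrite -map_comp. Qed.

Definition unprimeE := (map_cat, map_rev, unprime_Un, unprime_Pr, unprime_Out).

(** The last pass of a flip: no marked symbol is left, so the unary number just written is closed by
    a separator. *)
Lemma reach_find q l V o z : all isBk z ->
  reach (size V + size o).+1 (Find q, l, map Un V ++ map Out o ++ z)
    (left_of (Home q) (rev (map Out o) ++ rev (map Un V) ++ l) (Out true :: behead z)).
Proof.
move=> bz; rewrite -addn1; apply: reach_trans.
  rewrite catA -(size_map Un V) -(size_map Out o) -size_cat.
  apply: (@reach_right _ isUO) => [[]//|].
  by rewrite all_cat isUO_Un isUO_Out.
by apply: reach1; rewrite /= blank_head // rev_cat -catA.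
Qed.

(* The symbols of [U] are carried to the left end of the tape one at a time,
   each at the cost of one crossing of the tape in both directions. *)
Lemma reach_flip q S U A V o l z :
    all isBk l -> all isBk z -> size A + 3 * size U + size V + size o <= S ->
  exists W l' z', [/\ all isBk l' /\ all isBk z',
    pmap id W = rev (pmap id U) ++ pmap id A ++ pmap id V,
    size W = size A + size U + size (pmap id U) + size V
    & reach ((size U).+1 * (4 * S + 20))
      (Find q, rev (map Un A) ++ l, map Pr U ++ map Un V ++ map Out o ++ z)
      (Scan q, l', map Un W ++
        map Out (o ++ nseq (size (pmap id U)) false ++ [:: true]) ++ z')].
Proof.
elim: U A o l z => [|[a|] U IH] A o l z bl bz leS; rewrite /= in leS *.
- exists (A ++ V), (norm l), (behead z); split.
  + by rewrite norm_blankP ?blank_behead.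
  + by rewrite pmap_cat.
  + by rewrite size_cat; lia.
  have h1 := reach_find q (rev (map Un A) ++ l) V o bz.
  have h2 := @reach_home q l (rev (map Out o) ++ rev (map Un V) ++ rev (map Un A)) (Out true :: behead z) bl.
  move: h1 (h2 ltac:(by rewrite !nonBkE)); rewrite -!catA => h1 {}h2.
  move: (reach_trans h1 h2).
  rewrite !unprimeE !rev_cat !revK -!catA /=.
  by apply: reach_le; rewrite !sizeE; lia.
(* Carrying one symbol lengthens [A] by two cells, the moved symbol and its gap, and the output by
   one. This matches the weight 3 of [U] in the space bound. *)
- have [|||W [l' [z' [b' p' s' r']]]] :=
    IH (Some a :: rcons A None) (rcons o false) (norm (behead l)) (behead z).
  + by rewrite norm_blankP ?blank_behead.
  + by rewrite blank_behead.
  + by rewrite /= !sizeE; lia.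
  exists W, l', z'; split=> //.
  + by rewrite p' /= rev_cons cat_rcons -cats1 pmap_cat cats0.
  + by rewrite s' /= size_rcons; lia.
  have -> : o ++ false :: nseq (size (pmap id U)) false ++ [:: true] =
      rcons o false ++ nseq (size (pmap id U)) false ++ [:: true] by rewrite cat_rcons.
  rewrite mulSn; apply: reach_trans r'.
  pose X := map Pr U ++ map Un V ++ map Out o.
  have h1 : reach 1 (Find q, rev (map Un A) ++ l, Pr (Some a) :: X ++ z)
     (left_of (Carry q a) (rev (map Un A) ++ l) (Un None :: X ++ z)) by exact: reach1.
  have h2 : reach (size A) (left_of (Carry q a) (rev (map Un A) ++ l) (Un None :: X ++ z))
     (left_of (Carry q a) l (map Un A ++ Un None :: X ++ z)).
    have := @reach_left (Carry q a) nonBk id l (rev (map Un A)) (Un None :: X ++ z).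
    by rewrite map_id revK !sizeE; apply; rewrite ?nonBkE // => -[].
  have h3 : reach 1 (left_of (Carry q a) l (map Un A ++ Un None :: X ++ z))
     (App q, Un (Some a) :: behead l, (map Un (rcons A None) ++ X) ++ z).
    by apply: reach1; rewrite /= blank_head // map_rcons cat_rcons -catA.
  have h4 := @reach_right (App q) nonBk (Un (Some a) :: behead l) (map Un (rcons A None) ++ X) z.
  have {}h4 := h4 ltac:(by case) ltac:(by rewrite !nonBkE).
  have h5 : reach 1 (App q, rev (map Un (rcons A None) ++ X) ++ Un (Some a) :: behead l, z)
     (left_of (Back q) ((rev (map Un (rcons A None) ++ X) ++ [:: Un (Some a)]) ++ behead l)
        (Out false :: behead z)).
    by apply: reach1; rewrite /= blank_head // -catA.
  have h6 := @reach_back q (behead l) (rev (map Un (rcons A None) ++ X) ++ [:: Un (Some a)]) (Out false :: behead z).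
  have {}h6 := h6 ltac:(exact: blank_behead) ltac:(by rewrite !nonBkE).
  have E w x : rev (rev w ++ [:: x]) = x :: w :> seq cell by rewrite rev_cat revK.
  rewrite E /= -(catA (map Un _)) in h6.
  have h7 := @reach_right (Find q) isUO (norm (behead l)) (map Un (Some a :: rcons A None))
    (X ++ Out false :: behead z).
  have {}h7 := h7 ltac:(by case) ltac:(by rewrite isUO_Un).
  have := reach_trans h1 (reach_trans h2 (reach_trans h3 (reach_trans h4 (reach_trans h5 (reach_trans h6 h7))))).
  rewrite /X -!catA => {}h; rewrite (map_rcons Out) cat_rcons.
  by apply: reach_le h; rewrite /= !sizeE /=; lia.
- have [|W [l' [z' [b' p' s' r']]]] := IH (rcons A None) o l z bl bz.
  + by rewrite !sizeE; lia.
  exists W, l', z'; split=> //.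
  + by rewrite p' -cats1 pmap_cat cats0.
  + by rewrite s' /= size_rcons; lia.
  rewrite mulSn; apply: reach_trans r'.
  apply: (@reach_le 1); first lia.
  by apply: reach1; rewrite /= map_rcons rev_rcons.
Qed.

Definition scan_tape q U V o l z : tape :=
  (Scan q, rev (map Pr U) ++ l, map Un V ++ map Out o ++ z).

(** The controller never sees gaps, so the machine first skips them; afterwards the head is on a
    true symbol or past the string. *)
Lemma reach_gaps q U V o l z :
  exists U1 V1, [/\ pmap id U1 = pmap id U /\ pmap id V1 = pmap id V,
    size U1 + size V1 = size U + size V,
    V1 = [::] \/ (exists y V2, V1 = Some y :: V2)
    & reach (size V) (scan_tape q U V o l z) (scan_tape q U1 V1 o l z)].
Proof.
elim: V U => [|[y|] V IH] U.
- by exists U, [::]; split; [|by []|left|exact: reach0].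
- exists U, (Some y :: V); split=> //; first by right; exists y, V.
  exact: reach_le (reach0 _).
have [U1 [V1 [[p1 p2] s1 g1 r1]]] := IH (rcons U None).
exists U1, V1; split=> //.
- by rewrite p1 -cats1 pmap_cat cats0.
- by rewrite s1 size_rcons addSnnS.
rewrite -[size _]/((size V).+1) -add1n; apply: reach_trans r1.
by apply: reach1; rewrite /= /scan_tape map_rcons rev_rcons.
Qed.

Lemma delta_scan q V o z : all isBk z ->
    V = [::] \/ (exists y V2, V = Some y :: V2) ->
  let x := head Bk (map Un V ++ map Out o ++ z) in
  delta (Scan q) x =
    match d q (ohead (pmap id V)) with
    | Cont q' => Some (if V is Some y :: _ then (Scan q', Pr (Some y), MoveR)
                       else (Scan q', x, Stay))
    | Flip q' => Some (Back q', x, MoveL)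
    | Rewind q' => Some (Home q', x, MoveL)
    | Halt => None
    end.
Proof.
move=> bz [->|[y [V2 ->]]] /=; last by case: (d _ _).
by case: o => [|b o] /=; rewrite ?blank_head //; case: (d _ _).
Qed.

Definition flip_output (fl : seq nat) := flatten [seq nseq i false ++ [:: true] | i <- fl].

Definition step_bound S := S.+1 * (12 * S + 30).

(** Gaps are never removed: a flip adds one cell per moved symbol, which is the last term of the
    size bound. *)
Lemma reach_cstep S q U V o l z fl q' u' v' :
    all isBk l -> all isBk z -> size U + size V + size o <= S ->
    cstep d (q, pmap id U, pmap id V) = Some (fl, (q', u', v')) ->
  exists U' V' l' z', [/\ all isBk l' /\ all isBk z',
    u' = pmap id U' /\ v' = pmap id V',
    size U' + size V' <= size U + size V + size (pmap id U)
    & reach (step_bound S) (scan_tape q U V o l z)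
        (scan_tape q' U' V' (o ++ flip_output fl) l' z')].
Proof.
move=> bl bz leS; have [U1 [V1 [[<- <-] s1 g1 r1]]] := reach_gaps q U V o l z.
rewrite /step_bound /cstep; have := delta_scan q o bz g1.
have [z1 bz1 nE] := norm_blank V1 o bz.
case: (d q _) => // q1 /= dE [<- cE].
- case: g1 dE => [V1E|[y [V2 V1E]]] dE.
  + move: cE; rewrite V1E /= => -[<- <- <-].
    exists U1, [::], l, z1; split=> //; first by rewrite V1E in s1; rewrite -s1; lia.
    apply: (@reach_le (size V + 1)); first nia.
    apply: reach_trans r1 _; apply: reach1; rewrite /= dE V1E /=.
    by rewrite V1E /= /norm in nE; rewrite nE cats0.
  + move: cE; rewrite V1E /= => -[<- <- <-]; exists (rcons U1 (Some y)), V2, l, z; split=> //.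
    * by rewrite -!cats1 pmap_cat.
    * by rewrite size_rcons -s1 V1E /=; lia.
    apply: (@reach_le (size V + 1)); first nia.
    apply: reach_trans r1 _; apply: reach1; rewrite /= dE V1E /= cats0.
    by rewrite /scan_tape map_rcons rev_rcons.
- case: cE => <- <- <-.
  have h1 := @reach_back q1 l (rev (map Pr U1)) (map Un V1 ++ map Out o ++ z1) bl.
  have {}h1 := h1 ltac:(by rewrite !nonBkE).
  have h2 : reach 1 (scan_tape q U1 V1 o l z) (left_of (Back q1) (rev (map Pr U1) ++ l)
    (map Un V1 ++ map Out o ++ z1)) by apply: reach1; rewrite /= dE -nE.
  (* The space parameter is tripled because [reach_flip] counts the cells of [U] three times. *)
  have [||W [l' [z' [b' p' s' r']]]] := @reach_flip q1 (3 * S) U1 [::] V1 o (norm l) z1 _ bz1.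
  + exact: norm_blankP.
  + by rewrite /=; lia.
  exists [::], W, l', z'; split=> //.
  + by rewrite s' /=; lia.
  rewrite revK in h1.
  have := reach_trans r1 (reach_trans h2 (reach_trans h1 r')).
  rewrite /flip_output /= cats0; apply: reach_le; rewrite !sizeE.
  suff : (size U1).+1 * (4 * (3 * S) + 20) <= S.+1 * (12 * S + 20) by lia.
  by apply: leq_mul; lia.
- case: cE => <- <- <-.
  have h1 := @reach_home q1 l (rev (map Pr U1)) (map Un V1 ++ map Out o ++ z1) bl.
  have {}h1 := h1 ltac:(by rewrite !nonBkE).
  have h2 : reach 1 (scan_tape q U1 V1 o l z) (left_of (Home q1) (rev (map Pr U1) ++ l)
    (map Un V1 ++ map Out o ++ z1)) by apply: reach1; rewrite /= dE -nE.
  exists [::], (U1 ++ V1), (norm l), z1; split=> //.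
  + by rewrite norm_blankP.
  + by rewrite pmap_cat.
  + by rewrite /= size_cat; lia.
  rewrite unprimeE unprime_Pr revK in h1.
  have := reach_trans r1 (reach_trans h2 h1).
  rewrite /scan_tape /= cats0 map_cat -catA; apply: reach_le; rewrite !sizeE; nia.
Qed.

Lemma flip_output_cat fl1 fl2 :
  flip_output (fl1 ++ fl2) = flip_output fl1 ++ flip_output fl2.
Proof. by rewrite /flip_output map_cat flatten_cat. Qed.

Lemma size_flip_output_cstep q u v fl c :
  cstep d (q, u, v) = Some (fl, c) -> size (flip_output fl) <= (size u).+1.
Proof.
by rewrite /cstep; case: (d _ _) => // q' [<- _] //; rewrite /flip_output /= cats0 !sizeE addn1.
Qed.

Lemma cstep_size q u v fl q' u' v' :
  cstep d (q, u, v) = Some (fl, (q', u', v')) -> size u' + size v' = size u + size v.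
Proof.
rewrite /cstep; case: (d _ _) => // q1 [_]; case: v => [|y v] [_ <- <-] //=; rewrite ?sizeE /=; lia.
Qed.

(** On a string of length $n$, one controller step adds at most $n$ gaps and $n+1$ output cells;
    hence the summand $2n+1$ for each of the [T] steps. *)
Lemma reach_csteps S T q U V o l z fl q' u' v' :
    all isBk l -> all isBk z ->
    size U + size V + size o + T * (2 * (size (pmap id U) + size (pmap id V))).+1 <= S ->
    csteps d T (q, pmap id U, pmap id V) fl (q', u', v') ->
  exists U' V' l' z', [/\ all isBk l' /\ all isBk z',
    u' = pmap id U' /\ v' = pmap id V', size V' <= S
    & reach (T * step_bound S) (scan_tape q U V o l z)
        (scan_tape q' U' V' (o ++ flip_output fl) l' z')].
Proof.
elim: T q U V o l z fl => [|T IH] q U V o l z fl bl bz leS /=.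
  case=> -> [<- <- <-]; exists U, V, l, z; split=> //; first by lia.
  by rewrite cats0; exact: reach0.
move=> [fl1 [[[q1 u1] v1] [fl2 [s1 s2 ->]]]].
have leS1 : size U + size V + size o <= S by lia.
have [U1 [V1 [l1 [z1 [[bl1 bz1] [eu ev] ss r1]]]]] := reach_cstep bl bz leS1 s1.
have e1 := size_flip_output_cstep s1; have e2 := cstep_size s1.
rewrite eu ev in s2 e2.
have [|U2 [V2 [l2 [z2 [b2 p2 ss2 r2]]]]] := IH _ _ _ (o ++ flip_output fl1) _ _ _ bl1 bz1 _ s2.
  by rewrite e2 size_cat; lia.
exists U2, V2, l2, z2; split=> //.
by rewrite flip_output_cat catA mulSn; apply: reach_trans r1 r2.
Qed.

(** The controller halts at the end of the string. Once the trailing gaps are skipped, the head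
    stands on the first output cell, so what is read from there on is the output alone. *)
Lemma reach_halt T s fl q u :
    csteps d T (q0, [::], s) fl (q, u, [::]) -> d q None = Halt ->
    let S := size s + T * (2 * size s).+1 in
  exists l z, [/\ all isBk z,
     reach (T * step_bound S + S) (Scan q0, [::], map (fun a => Un (Some a)) s)
        (Scan q, l, map Out (flip_output fl) ++ z)
   & tstep (Scan q, l, map Out (flip_output fl) ++ z) = None].
Proof.
move=> st dq S.
have pE : pmap id (map Some s) = s by elim: (s) => //= a s' ->.
have h := @reach_csteps S T q0 [::] (map Some s) [::] [::] [::] fl q u [::] isT isT.
have [||U [V [l [z [[bl bz] [_ eV] sV r]]]]] := h.
- by rewrite /= pE size_map addn0.
- by rewrite /= pE.
have [U1 [V1 [[_ p1] _ g1 r1]]] := reach_gaps q U V (flip_output fl) l z.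
have V1E : V1 = [::] by case: g1 p1 => [->//|[y [V2 ->]]]; rewrite -eV.
have := delta_scan q (flip_output fl) bz g1.
rewrite V1E /= dq => dE; rewrite V1E in r1.
exists (rev (map Pr U1) ++ l), z; split=> //; last by rewrite /= dE.
have := reach_trans r (reach_le sV r1).
by rewrite /scan_tape /= cats0 -map_comp.
Qed.

(** * Numbering states and cells: the concrete Turing machine *)

Definition ctl_code (p : ctl) : 'I_(#|{: ctl}|).+1 :=
  if p == Scan q0 then ord0 else lift ord0 (enum_rank p).

Definition ctl_decode (i : 'I_(#|{: ctl}|).+1) : ctl :=
  if unlift ord0 i is Some j then enum_val j else Scan q0.

Lemma ctl_codeK : cancel ctl_code ctl_decode.
Proof.
move=> p; rewrite /ctl_code /ctl_decode; case: eqP => [->|_].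
  by rewrite unlift_none.
by rewrite liftK enum_rankK.
Qed.

(** The codes 0, 1, 2 and [a + 3] are those prescribed for blank, output and input; gaps and marked
    symbols follow, up to $2k+4$. *)
Definition cell_nat (x : cell) : nat :=
  match x with
  | Bk => 0
  | Out b => b.+1
  | Un (Some a) => a + 3
  | Un None => k + 3
  | Pr None => k + 4
  | Pr (Some a) => a + k + 5
  end.

Definition nat_cell (n : nat) : cell :=
  match n with
  | 0 => Bk
  | 1 => Out false
  | 2 => Out true
  | n'.+3 =>
      if insub n' is Some a then Un (Some a)
      else if n' == k then Un None
      else if n' == k.+1 then Pr None
      else if insub (n' - k.+2) is Some a then Pr (Some a) else Bk
  end.

Definition cell_code (x : cell) : 'I_(k.*2 + 4).+1 := inord (cell_nat x).

Lemma cell_natK : cancel cell_nat nat_cell.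
Proof.
case=> [|[]|[a|]|[a|]] //=.
- by rewrite addn3 /= valK.
- by rewrite addn3 /= insubF ?ltnn // eqxx.
- rewrite (_ : a + k + 5 = (a + k + 2).+3) /=; last by lia.
  rewrite insubF; last by lia.
  rewrite ifN; last by lia.
  rewrite ifN; last by lia.
  by rewrite (_ : _ - _ = a) ?valK //; lia.
- rewrite addn4 /= insubF; last by lia.
  by rewrite ifN ?eqxx //; lia.
Qed.

Lemma cell_codeE x : cell_code x = cell_nat x :> nat.
Proof.
rewrite /cell_code inordK //.
case: x => [|[]|[a|]|[a|]] /=; rewrite -?addnn; try lia.
  by have := ltn_ord a; lia.
by have := ltn_ord a; lia.
Qed.

Definition machine : TM := {|
  tm_nQ := #|{: ctl}|;
  tm_nG := k.*2 + 4;
  tm_delta := fun q a =>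
    omap (fun '(p, x, mv) => (ctl_code p, cell_code x, mv))
      (delta (ctl_decode q) (nat_cell a)) |}.

Definition tape_config (c : tape) : config machine :=
  let: (p, l, r) := c in
  (ctl_code p, map cell_code l, cell_code (head Bk r), map cell_code (behead r)).

Lemma cell_code_Bk : cell_code Bk = ord0.
Proof. by apply: val_inj; rewrite /= cell_codeE. Qed.

Lemma head_cell_code l : head ord0 (map cell_code l) = cell_code (head Bk l).
Proof. by case: l => //=; rewrite cell_code_Bk. Qed.

Lemma behead_map_code l : behead (map cell_code l) = map cell_code (behead l).
Proof. by case: l. Qed.

Lemma step_tape_config c : step (tape_config c) = omap tape_config (tstep c).
Proof.
case: c => [[p l] r]; rewrite /step /tape_config /tstep /=.
rewrite ctl_codeK cell_codeE cell_natK.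
case: (delta p _) => [[[p' b] mv]|] //=.
by case: mv; rewrite /= ?head_cell_code ?behead_map_code.
Qed.

Lemma run_tape_config B T c c' : reach B c c' -> B <= T -> tstep c' = None ->
  run T (tape_config c) = Some (tape_config c').
Proof.
move=> [n lenB e] leBT hc; have := leq_trans lenB leBT; clear B lenB leBT.
elim: T n c e => [|T IH] [|n] c /=.
- by case=> -> _; rewrite step_tape_config hc.
- by [].
- by case=> -> _; rewrite step_tape_config hc.
rewrite step_tape_config; case: (tstep c) => //= c1 e; exact: IH.
Qed.

Lemma decode_flip_output fl :
  decode_flips (map (fun b : bool => b.+1) (flip_output fl)) = Some fl.
Proof.
rewrite /decode_flips; elim: fl => //= i fl IH.
have aux n m w : decode_aux n (map (fun b : bool => b.+1) (nseq m false ++ w)) =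
    decode_aux (n + m) (map (fun b : bool => b.+1) w).
  by elim: m n => [|m IHm] n /=; rewrite ?addn0 // IHm addnS addSn.
by rewrite /flip_output /= -catA aux add0n /= IH.
Qed.

Lemma output_tape_config p l o z : all isBk z ->
  output (tape_config (p, l, map Out o ++ z)) = map (fun b : bool => b.+1) o.
Proof.
move=> bz; rewrite /output /tape_config -map_cons -map_comp.
have E : val \o cell_code =1 cell_nat by move=> x; rewrite /= cell_codeE.
rewrite (eq_map E) {E}.
case: o => [|b o] /=; first by rewrite blank_head.
congr cons; elim: o => [|b' o IH] /=; last by rewrite IH.
by case: z bz => [|x z] //= /andP[]; case: x.
Qed.

Lemma machine_outputs T s fl q u t :
    csteps d T (q0, [::], s) fl (q, u, [::]) -> d q None = Halt ->
    (let S := size s + T * (2 * size s).+1 in T * step_bound S + S) <= t ->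
  tm_outputs machine t s fl.
Proof.
move=> st dq /= let_; have [l [z [bz r hz]]] := reach_halt st dq.
eexists; split.
  rewrite (_ : init _ = tape_config (Scan q0, [::], map (fun a => Un (Some a)) s)).
    exact: run_tape_config r let_ hz.
  rewrite /init /tape_config -head_cell_code -behead_map_code /ctl_code eqxx.
  by rewrite /encode_input -map_comp.
by rewrite output_tape_config // decode_flip_output.
Qed.

End Simulation.

(** * Runs and the flip distance *)

Section Runs.
Variable T : eqType.
Implicit Types (a : T) (s x y w : seq T).

Definition push a w := if ohead w == Some a then w else a :: w.

(** The string of runs: every maximal constant block is contracted to one symbol. *)
Definition red s := foldr push [::] s.
Arguments red : simpl never.

Definition runs s := size (red s).

Lemma ohead_cat x y : ohead (x ++ y) = if x is [::] then ohead y else ohead x.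
Proof. by case: x. Qed.

Lemma ohead_rev_rcons s a : ohead (rev (rcons s a)) = Some a.
Proof. by rewrite rev_rcons. Qed.

Lemma ohead_red s : ohead (red s) = ohead s.
Proof. by case: s => //= a s; rewrite /red /= /push; case: eqP. Qed.

Lemma red_cons a s : red (a :: s) = if ohead s == Some a then red s else a :: red s.
Proof. by rewrite /red /= /push ohead_red. Qed.

Lemma red_rcons s a :
  red (rcons s a) = if ohead (rev s) == Some a then red s else rcons (red s) a.
Proof.
elim: s => [|b s IH] //; rewrite rcons_cons !red_cons IH rev_cons.
case: s {IH} => [|c s] //=; first by rewrite /push /= [Some a == _]eq_sym; case: eqP => // -[->].
rewrite rev_cons -!cats1 -catA !ohead_cat.
by case: (rev s) => [|e s'] /=; case: ifP => //; case: ifP.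
Qed.

Lemma red_rev s : red (rev s) = rev (red s).
Proof.
elim: s => // a s IH; rewrite rev_cons red_rcons red_cons revK IH.
by case: ifP => // _; rewrite rev_cons.
Qed.

Lemma runs_rev s : runs (rev s) = runs s.
Proof. by rewrite /runs red_rev size_rev. Qed.

(** Tells whether the last run of [x] fuses with the first run of [y]. The test [x != [::]] excludes
    the coincidence of two [None] for two empty strings. *)
Definition junction x y := (x != [::]) && (ohead (rev x) == ohead y).

Lemma runs_cat x y : runs (x ++ y) + junction x y = runs x + runs y.
Proof.
rewrite /runs /junction; elim: x => [|a x IH] /=; first by rewrite addn0.
rewrite !red_cons ohead_cat rev_cons.
case: x IH => [|b x] /= IH; first by rewrite eq_sym; case: eqP => /=; rewrite ?addn0 ?addn1.
rewrite rev_cons -!cats1 -catA !ohead_cat in IH *.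
by case: (rev x) IH => [|e s'] /=; case: ifP => //= _; rewrite !addSn => ->.
Qed.

Lemma runs_catl x y : runs x <= runs (x ++ y).
Proof.
have := runs_cat x y; case: y => [|b y]; first by rewrite cats0.
have : 0 < runs (b :: y) by rewrite /runs; case: (red _) (ohead_red (b :: y)).
by case: (junction _ _); lia.
Qed.

Lemma subseq_red s : subseq (red s) s.
Proof.
elim: s => // a s IH; rewrite red_cons; case: ifP => _ /=; last by rewrite eqxx.
exact: subseq_trans IH (subseq_cons _ _).
Qed.

Lemma subseq_red_cat x y : subseq (red (x ++ y)) (red x ++ red y).
Proof.
elim: x => // a x IH; rewrite cat_cons !red_cons ohead_cat.
case: x IH => [|b x] IH; last by case: ifP => // _; rewrite cat_cons /= eqxx.
by case: ifP => _; [exact: subseq_cons | exact: subseq_refl].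
Qed.

(** Lifts a cut of the string of runs to a cut of [s] at a run boundary, so that a flip of [red s]
    can be imitated on [s]. *)
Lemma red_split i s : i <= runs s ->
  exists x y, [/\ s = x ++ y, red x = take i (red s) & red y = drop i (red s)].
Proof.
rewrite /runs; elim: s i => [|a s IH] [|i].
- by exists [::], [::].
- by [].
- by exists [::], (a :: s); rewrite take0 drop0.
rewrite red_cons; case: ifP => ha lei.
  have [x [y [sE ex ey]]] := IH _ lei.
  exists (a :: x), y; split=> //; first by rewrite sE.
  rewrite red_cons -ohead_red ex (_ : ohead (take _ _) = ohead s) ?ha //.
  by rewrite -(ohead_red s); case: (red s).
have [x [y [sE ex ey]]] := IH _ lei.
exists (a :: x), y; split=> //; first by rewrite sE.
rewrite red_cons -ohead_red ex; case: (i) => [|i']; first by rewrite /= !take0.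
by rewrite (_ : ohead (take _ _) = ohead s) ?ha // -(ohead_red s); case: (red s).
Qed.

Lemma sorted_red (r : rel T) s : reflexive r -> sorted r (red s) -> sorted r s.
Proof.
move=> rr; elim: s => // a s IH; rewrite red_cons.
case: s IH => // b s IH /=; case: eqP => [[<-]|_] h.
  by rewrite rr; exact: IH.
case: (red (b :: s)) (ohead_red (b :: s)) h IH => //= c t [->] /andP[-> h] IH.
exact: IH.
Qed.

Lemma red_sorted (r r' : rel T) s :
  (forall a b, r a b -> a != b -> r' a b) -> sorted r s -> sorted r' (red s).
Proof.
move=> rr'; elim: s => // a [|b s] IH // /andP[ab h]; have {IH h} := IH h.
rewrite (red_cons a) /=; case: eqP => // ne.
case: (red (b :: s)) (ohead_red (b :: s)) => //= c t [->] ->.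
by rewrite rr' //; apply/eqP => e; rewrite e in ne.
Qed.

(** Reversing the prefix keeps its number of runs; only the fusion at the cut can change, and it is
    worth at most one run. *)
Lemma runs_flip i s : runs s <= (runs (flip i s)).+1.
Proof.
rewrite /flip; have := runs_cat (take i s) (drop i s).
have := runs_cat (rev (take i s)) (drop i s).
rewrite runs_rev cat_take_drop; lia.
Qed.

Lemma runs_nseq a j : runs (nseq j.+1 a) = 1.
Proof. by rewrite /runs; elim: j => // j; rewrite [nseq j.+2 a]/= red_cons /= eqxx. Qed.

(** There is no fusion at the cut before the flip, and one after it, because [x] begins with the
    symbol that [w] begins with. *)
Lemma runs_flip_merge x w : x != [::] -> ohead x = ohead w ->
  ohead (rev x) != ohead w -> (runs (rev x ++ w)).+1 = runs (x ++ w).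
Proof.
move=> x0 hx hr; have := runs_cat x w; have := runs_cat (rev x) w.
by rewrite runs_rev /junction (negPf hr) revK hx eqxx -size_eq0 size_rev size_eq0 x0 /=; lia.
Qed.

Lemma runs_flip_boundary x y : ohead (rev x) != ohead y -> runs (rev x ++ y) <= runs (x ++ y).
Proof.
move=> hr; have := runs_cat x y; have := runs_cat (rev x) y.
by rewrite runs_rev /junction (negPf hr) andbF; lia.
Qed.

End Runs.
Arguments red : simpl never.

(** * The flip distance: monotonicity, contraction of runs and a lower bound *)

Section Sorting.
Variable k : nat.
Implicit Types (s t x y : seq 'I_k).

Definition leI (a b : 'I_k) := (a <= b)%N.

Lemma leI_total : total leI. Proof. by move=> a b; apply: leq_total. Qed.
Lemma leI_trans : transitive leI. Proof. by move=> a b c; apply: leq_trans. Qed.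
Lemma leI_anti : antisymmetric leI.
Proof. by move=> a b /anti_leq /val_inj. Qed.

Lemma size_flip (T : Type) i (s : seq T) : size (flip i s) = size s.
Proof. by rewrite /flip size_cat size_rev -size_cat cat_take_drop. Qed.

Lemma perm_flip (T : eqType) i (s : seq T) : perm_eq (flip i s) s.
Proof. by rewrite /flip -{3}(cat_take_drop i s) perm_cat2r perm_rev. Qed.

Lemma flip_rcons (T : Type) i (s : seq T) a : i <= size s -> flip i (rcons s a) = rcons (flip i s) a.
Proof.
move=> le; rewrite /flip -cats1 take_cat drop_cat; case: ltngtP le => // [|->] _.
  by rewrite -cats1 catA.
by rewrite subnn take0 drop0 cats0 take_size drop_size cats0 cats1.
Qed.

Lemma I_sort_perm s t : perm_eq s t -> I_sort s = I_sort t.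
Proof. by move/(perm_sortP leI_total leI_trans leI_anti). Qed.

Lemma I_sort_flip i s : I_sort (flip i s) = I_sort s.
Proof. exact/I_sort_perm/perm_flip. Qed.

Lemma I_sort_id s : s = I_sort s <-> sorted leI s.
Proof.
split=> [->|h]; first exact: (sort_sorted leI_total).
by rewrite [RHS](sorted_sort leI_trans).
Qed.

Lemma valid_flips_flip s i fl : valid_flips (flip i s) fl = valid_flips s fl.
Proof. by rewrite /valid_flips size_flip. Qed.

Lemma sortable_inP m t u :
  sortable_in m t u <-> exists fl, [/\ size fl = m, valid_flips t fl & apply_flips fl t = u].
Proof.
elim: m t => [|m IH] t /=.
  by split=> [/eqP<-|[[|i fl] [] // _ _ <-]]; first by exists [::].
split=> [/hasP[i]|[[|i fl] [] // [sz] /= /andP[vi v] e]].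
  rewrite mem_iota => vi /IH[fl [sz v e]]; exists (i :: fl); split=> //=; first by rewrite sz.
  by rewrite valid_flips_flip in v; rewrite -/(valid_flips t fl) v andbT; lia.
apply/hasP; exists i; first by rewrite mem_iota; lia.
by apply/IH; exists fl; rewrite valid_flips_flip.
Qed.

Lemma reachable_perm s t : perm_eq s t -> exists fl, valid_flips s fl /\ apply_flips fl s = t.
Proof.
elim/last_ind: t s => [|t a IH] s p.
  by move: (perm_size p) => /size0nil ->; exists [::].
have sa : a \in s by rewrite (perm_mem p) mem_rcons mem_head.
have lt : index a s < size s by rewrite index_mem.
have [s' E] : exists s', flip (size s) (flip (index a s).+1 s) = rcons s' a.
  exists (rev (rev (take (index a s) s) ++ drop (index a s).+1 s)).
  rewrite {1}/flip -{1}(size_flip (index a s).+1 s) take_size drop_oversize ?size_flip // cats0.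
  by rewrite /flip (take_nth a) // nth_index // rev_rcons -rev_cons.
have ps : perm_eq s' t.
  have : perm_eq (rcons s' a) (rcons t a).
    by apply: perm_trans p; rewrite -E; apply: perm_trans (perm_flip _ _) (perm_flip _ _).
  by rewrite -!cats1 perm_cat2r.
have [fl [v e]] := IH _ ps.
have ss : size s = (size s').+1 by rewrite (perm_size p) size_rcons (perm_size ps).
exists [:: (index a s).+1, size s & fl]; split.
  rewrite /valid_flips /= lt leqnn /= ss /=.
  by apply: sub_all v => i /andP[-> /= h]; exact: leqW.
rewrite /= E -e {e E p IH}; elim: fl s' {ps ss} v => //= i fl IH s' /andP[/andP[_ hi] v].
by rewrite flip_rcons // IH // -/(valid_flips _ _) valid_flips_flip.
Qed.

Lemma sortable_in_steps_exists s : exists m, sortable_in_steps s m.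
Proof.
have [|fl [v e]] := @reachable_perm s (I_sort s); first by rewrite perm_sym perm_sort.
by exists (size fl); apply/sortable_inP; exists fl.
Qed.

Lemma d_sP s : sortable_in_steps s (d_s s).
Proof.
rewrite /d_s; case: pselect => [h|]; first by case: ex_minnP.
by case; exact: sortable_in_steps_exists.
Qed.

Lemma d_s_min s m : sortable_in_steps s m -> d_s s <= m.
Proof.
rewrite /d_s; case: pselect => [h|//]; case: ex_minnP => n _ nmin; exact: nmin.
Qed.

Lemma d_s_eq0 s : (d_s s == 0) = sorted leI s.
Proof.
apply/eqP/idP => [e|/I_sort_id e].
  by have := d_sP s; rewrite e /sortable_in_steps /= => /eqP /I_sort_id.
by apply/eqP; rewrite -leqn0; apply: d_s_min; apply/eqP.
Qed.

Lemma d_s_flip i s : 0 < i <= size s -> d_s s <= (d_s (flip i s)).+1.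
Proof.
move=> hi; apply: d_s_min; rewrite /sortable_in_steps /=.
apply/hasP; exists i; first by rewrite mem_iota; lia.
by have := d_sP (flip i s); rewrite /sortable_in_steps I_sort_flip.
Qed.

Lemma d_s_step s : 0 < d_s s -> exists2 i, 0 < i <= size s & d_s (flip i s) < d_s s.
Proof.
have := d_sP s; case: (d_s s) => // m /hasP[i].
rewrite mem_iota => hi h _; exists i; first by lia.
by rewrite ltnS; apply: d_s_min; rewrite /sortable_in_steps I_sort_flip.
Qed.

Lemma mask_take_drop (T : Type) i b (s : seq T) : size b = size s ->
  mask b s = mask (take i b) (take i s) ++ mask (drop i b) (drop i s).
Proof. by move=> sb; rewrite -mask_cat ?size_take ?sb // !cat_take_drop. Qed.

(** Flipping the mask along with the string makes a subsequence undergo a flip too, cut after the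
    kept symbols of the prefix. *)
Lemma mask_flip (T : Type) i b (s : seq T) : size b = size s ->
  mask (flip i b) (flip i s) = flip (size (mask (take i b) (take i s))) (mask b s).
Proof.
move=> sb; have hs : size (take i b) = size (take i s) by rewrite !size_take sb.
rewrite {1 2}/flip mask_cat ?size_rev // -rev_mask //.
by rewrite (mask_take_drop i sb) /flip take_size_cat // drop_size_cat.
Qed.

Lemma d_s_subseq s t : subseq t s -> d_s t <= d_s s.
Proof.
move Em: (d_s s) => m; elim: m s t Em => [|m IH] s t Em sub.
  rewrite leqn0 d_s_eq0; apply: subseq_sorted leI_trans _ _ sub _.
  by rewrite -d_s_eq0 Em.
have [i hi lt] : exists2 i, 0 < i <= size s & d_s (flip i s) < d_s s.
  by apply: d_s_step; rewrite Em.
have {}lt : d_s (flip i s) = m by have := d_s_flip hi; lia.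
have [b sb tE] := subseqP sub.
rewrite tE; have := IH _ (mask (flip i b) (flip i s)) lt (mask_subseq _ _).
rewrite mask_flip //; set j := size _.
(* If no kept symbol lies in the flipped prefix, the induced flip has length 0: it is not a valid
   move, but it changes nothing. *)
case: (posnP j) => [->|pos h].
  by rewrite /flip take0 drop0 /= => h; lia.
apply: leq_trans (d_s_flip (i := j) _) _ => //.
by rewrite pos (mask_take_drop i sb) size_cat leq_addr.
Qed.

Lemma subseq_red_flip x y i s : red x = take i (red s) ->
  red y = drop i (red s) -> subseq (red (rev x ++ y)) (flip i (red s)).
Proof. by move=> ex ey; rewrite /flip -ex -ey -red_rev subseq_red_cat. Qed.

(** One inequality is monotonicity under subsequences. For the other, optimal flips of [red s] are
    imitated on [s] at run boundaries; runs may fuse at the cut, so the new string of runs is only a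
    subsequence of the flipped [red s], and the induction is a strong one. *)
Lemma d_s_red s : d_s (red s) = d_s s.
Proof.
apply/eqP; rewrite eqn_leq d_s_subseq ?subseq_red //=.
move Em: (d_s (red s)) => m; elim: m {-2}m (leqnn m) s Em => [|n IH] m lemn s Em.
  by move: lemn; rewrite leqn0 -Em d_s_eq0 => /sorted_red-/(_ (fun=> leqnn _)); rewrite -d_s_eq0 => /eqP->.
case: (posnP m) => [m0|pm].
  by move: m0; rewrite -Em => /eqP; rewrite d_s_eq0 => /sorted_red-/(_ (fun=> leqnn _)); rewrite -d_s_eq0 => /eqP->.
have [i hi lt] : exists2 i, 0 < i <= runs s & d_s (flip i (red s)) < d_s (red s).
  by apply: d_s_step; rewrite Em.
have /andP[i0 ile] := hi.
have [x [y [sE ex ey]]] := red_split ile.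
have le := d_s_subseq (subseq_red_flip ex ey).
have x0 : 0 < size x.
  by apply: leq_trans (size_subseq (subseq_red x)); rewrite ex size_takel.
have fE : flip (size x) s = rev x ++ y by rewrite /flip sE take_size_cat ?drop_size_cat.
have hx : 0 < size x <= size s by rewrite x0 sE size_cat leq_addr.
have := d_s_flip hx; rewrite fE => /leq_trans; apply; rewrite -Em.
apply: (leq_ltn_trans (leq_trans _ le) lt); apply: IH erefl.
by rewrite -ltnS; apply: leq_trans lemn; rewrite -Em; apply: leq_ltn_trans le lt.
Qed.

(** Neighbours in [red s] differ, so for sorted [s] it is strictly increasing and has no repeated
    symbol. *)
Lemma runs_sorted s : sorted leI s -> runs s <= k.
Proof.
move=> h; have u : uniq (red s).
  apply: (@sorted_uniq _ (fun a b : 'I_k => (a < b)%N)).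
  - by move=> a b c; apply: ltn_trans.
  - by move=> a; rewrite ltnn.
  apply: red_sorted h => a b ab ne; rewrite ltn_neqAle [_ <= _]ab andbT.
  by apply: contra ne => /eqP/val_inj->.
by have := max_card (mem (red s)); rewrite card_ord (card_uniqP u).
Qed.

Lemma runs_le_d_s s : runs s <= d_s s + k.
Proof.
move Em: (d_s s) => m; elim: m s Em => [|m IH] s Em.
  by apply: runs_sorted; rewrite -d_s_eq0 Em.
have [i hi lt] : exists2 i, 0 < i <= size s & d_s (flip i s) < d_s s.
  by apply: d_s_step; rewrite Em.
have {}lt : d_s (flip i s) = m by have := d_s_flip hi; lia.
by rewrite addSn; apply: leq_trans (runs_flip i s) _; apply: IH lt.
Qed.

End Sorting.

(** * The sorting controller *)

Section BoundedRuns.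
Variables (k : nat) (Q : Type) (d : controller k Q).

Definition crun B c fl c' := exists2 T, T <= B & csteps d T c fl c'.

Lemma crun0 c : crun 0 c [::] c.
Proof. by exists 0. Qed.

Lemma crun_trans B1 B2 c1 c2 c3 f1 f2 :
  crun B1 c1 f1 c2 -> crun B2 c2 f2 c3 -> crun (B1 + B2) c1 (f1 ++ f2) c3.
Proof.
move=> [T1 le1 h1] [T2 le2 h2]; exists (T1 + T2); first exact: leq_add.
elim: T1 c1 f1 h1 {le1} => [|T1 IH] c1 f1 /=; first by case=> -> ->.
move=> [g1 [c [g2 [s1 s2 ->]]]]; exists g1, c, (g2 ++ f2); split=> //.
  exact: IH.
by rewrite catA.
Qed.

Lemma crun_step B c1 c2 c3 f1 f2 :
  cstep d c1 = Some (f1, c2) -> crun B c2 f2 c3 -> crun B.+1 c1 (f1 ++ f2) c3.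
Proof.
by move=> e [T le h]; exists T.+1 => //=; exists f1, c2, f2.
Qed.

Lemma crun_silent B c1 c2 c3 f :
  cstep d c1 = Some ([::], c2) -> crun B c2 f c3 -> crun B.+1 c1 f c3.
Proof. exact: crun_step. Qed.

Lemma crun_last c1 c2 f : cstep d c1 = Some (f, c2) -> crun 1 c1 f c2.
Proof. by move=> e; rewrite -(cats0 f); apply: crun_step e (crun0 _). Qed.

Lemma crun_le B1 B2 c fl c' : B1 <= B2 -> crun B1 c fl c' -> crun B2 c fl c'.
Proof. by move=> le [T leT h]; exists T => //; apply: leq_trans leT le. Qed.

End BoundedRuns.

Section Algorithm.
Variables (k N : nat).
Implicit Types (s t u v w x y z : seq 'I_k) (F : {set 'I_k}) (a b : 'I_k).

(* [Greedy F] starts a greedy round in which the symbols of [F] are the frozen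
   ones; [InFirst F a] scans the first run, consisting of [a]s, and
   [PastFirst F a] the symbols after it. *)
Inductive cst :=
  | Gather of N.-bseq 'I_k
  | Cut of N.-bseq 'I_k
  | Greedy of {set 'I_k}
  | InFirst of {set 'I_k} & 'I_k
  | PastFirst of {set 'I_k} & 'I_k.

Definition cst_sum (q : cst) :
    N.-bseq 'I_k + (N.-bseq 'I_k + ({set 'I_k} + ({set 'I_k} * 'I_k + {set 'I_k} * 'I_k))) :=
  match q with
  | Gather w => inl w
  | Cut w => inr (inl w)
  | Greedy F => inr (inr (inl F))
  | InFirst F a => inr (inr (inr (inl (F, a))))
  | PastFirst F a => inr (inr (inr (inr (F, a))))
  end.

Definition sum_cst
    (q : N.-bseq 'I_k + (N.-bseq 'I_k + ({set 'I_k} + ({set 'I_k} * 'I_k + {set 'I_k} * 'I_k)))) :=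
  match q with
  | inl w => Gather w
  | inr (inl w) => Cut w
  | inr (inr (inl F)) => Greedy F
  | inr (inr (inr (inl (F, a)))) => InFirst F a
  | inr (inr (inr (inr (F, a)))) => PastFirst F a
  end.

Lemma cst_sumK : cancel cst_sum sum_cst.
Proof. by case. Qed.

HB.instance Definition _ := Finite.copy cst (can_type cst_sumK).

(** The controller consults this only for strings of length at most [N], so it acts as a finite
    table and its evaluation costs no machine time. *)
Definition best_flip w : option 'I_(size w).+1 :=
  [pick i : 'I_(size w).+1 | (0 < i) && (d_s (flip i w) < d_s w)].

Definition snoc w a := if ohead (rev w) == Some a then w else rcons w a.

Definition gather0 := Gather [bseq].

(** [Gather] collects the string of runs and turns to the greedy mode if it exceeds [N]. In [Cut p],
    [p] lists the runs still to be crossed before the flip, the current one first. [InFirst] differs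
    from [PastFirst] because a repetition inside the first run does not count as a recurrence. A
    frozen first symbol, or an empty string, ends the greedy mode. *)
Definition sorter : controller k cst := fun q o =>
  match q, o with
  | Gather w, Some a =>
      if size (snoc w a) <= N then Cont (Gather (insub_bseq N (snoc w a)))
      else Rewind (Greedy set0)
  | Gather w, None =>
      if best_flip w is Some i then Rewind (Cut (insub_bseq N (take i w))) else Halt
  | Cut p, Some a =>
      if ohead p == Some a then Cont (Cut p)
      else if behead p is [::] then Flip gather0 else Cont (Cut (insub_bseq N (behead p)))
  | Cut p, None => Flip gather0
  | Greedy F, Some a => if a \in F then Rewind gather0 else Cont (InFirst F a)
  | Greedy F, None => Rewind gather0
  | InFirst F a, Some b =>
      if b == a then Cont (InFirst F a)
      else if b \in F then Flip (Greedy (a |: F)) else Cont (PastFirst F a)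
  | PastFirst F a, Some b =>
      if b == a then Flip (Greedy F)
      else if b \in F then Flip (Greedy (a |: F)) else Cont (PastFirst F a)
  | InFirst F a, None => Flip (Greedy (a |: F))
  | PastFirst F a, None => Flip (Greedy (a |: F))
  end.

Lemma val_insub w : size w <= N -> insub_bseq N w = w :> seq _.
Proof. by move=> h; rewrite /insub_bseq val_insubd h. Qed.

Lemma snoc_red u a : snoc (red u) a = red (rcons u a).
Proof. by rewrite red_rcons /snoc -red_rev ohead_red. Qed.

Lemma run_gather u v : runs u <= N ->
  if runs (u ++ v) <= N then
    crun sorter (size v) (Gather (insub_bseq N (red u)), u, v) [::]
      (Gather (insub_bseq N (red (u ++ v))), u ++ v, [::])
  else
    crun sorter (size v) (Gather (insub_bseq N (red u)), u, v) [::]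
      (Greedy set0, [::], u ++ v).
Proof.
elim: v u => [|a v IH] u hu; first by rewrite cats0 hu; exact: crun0.
have [le|gt] := leqP (runs (rcons u a)) N; last first.
  rewrite ifN -?ltnNge; last first.
    by rewrite -cat_rcons; apply: leq_trans gt (runs_catl _ _).
  apply: crun_silent.
    by rewrite /= val_insub // snoc_red leqNgt gt.
  exact: crun_le (crun0 _ _).
move: (IH _ le); rewrite cat_rcons.
by case: ifP => _ h; apply: crun_silent h;
  rewrite /= val_insub // snoc_red le.
Qed.

(** Invariant of the second scan: the state holds the runs of the unread part of the prefix,
    including the run of the symbol read last. *)
Lemma run_cut b p x u y : size (b :: p) <= N -> red (b :: x) = b :: p ->
  crun sorter (size x) (Cut (insub_bseq N (b :: p)), u, x ++ y) [::]
    (Cut (insub_bseq N [:: last b x]), u ++ x, y).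
Proof.
elim: x b p u => [|c x IH] b p u szp.
  by rewrite cats0 => -[<-]; exact: crun0.
rewrite red_cons /= -cat_rcons; case: eqP => [[->]|ne] e.
  apply: crun_silent; last exact: IH e.
  by rewrite /= val_insub //= eqxx.
case: e => e; have [p' pE] : exists p', p = c :: p'.
  by have := ohead_red (c :: x); rewrite e; case: (p) => //= c' p' [->]; exists p'.
apply: crun_silent; last first.
  apply: (IH c p'); last by rewrite e.
  by apply: leq_trans szp; rewrite pE.
rewrite /= val_insub //= ifN; last by apply/eqP => -[h]; case: ne; rewrite h.
by rewrite pE.
Qed.

Lemma run_gather_all s : runs s <= N ->
  crun sorter (size s) (gather0, [::], s) [::] (Gather (insub_bseq N (red s)), s, [::]).
Proof.
move=> hs; have := @run_gather [::] s (leq0n _); rewrite /= hs.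
by rewrite (_ : insub_bseq N (red [::]) = [bseq]) //; apply: val_inj; rewrite /= val_insub.
Qed.

Lemma best_flip_some w : 0 < d_s w -> exists i, best_flip w = Some i.
Proof.
move=> pos; rewrite /best_flip; case: pickP => [i _|no]; first by exists i.
have [j /andP[j0 lej] ltj] := d_s_step pos.
by have := no (Ordinal (lej : j < (size w).+1)); rewrite /= j0 ltj.
Qed.

Lemma exact_round s : runs s <= N -> 0 < d_s s ->
  exists x y, [/\ s = x ++ y, x != [::], d_s (rev x ++ y) < d_s s, runs (rev x ++ y) <= N
    & crun sorter (2 * size s + 3) (gather0, [::], s) [:: size x] (gather0, [::], rev x ++ y)].
Proof.
move=> hs; rewrite -d_s_red => pos; have [i Ei] := best_flip_some pos.
have [i0 lt] : 0 < i /\ d_s (flip i (red s)) < d_s (red s).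
  by move: Ei; rewrite /best_flip; case: pickP => // j /andP[j0 ltj] [<-].
have [x [y [sE ex ey]]] := red_split (ltn_ord i : i <= runs s).
have runsE : runs s = runs x + runs y.
  by rewrite {2 3}/runs ex ey -size_cat cat_take_drop.
case: x sE ex runsE => [|b x] sE ex runsE.
  by move: i0; rewrite -(size_takel (ltn_ord i : i <= size (red s))) -ex.
exists (b :: x), y; split=> //.
- by apply: leq_ltn_trans lt; rewrite -d_s_red; apply: d_s_subseq; apply: subseq_red_flip ex ey.
- by have := runs_cat (rev (b :: x)) y; rewrite runs_rev -runsE; move=> h; apply: leq_trans hs; rewrite -h leq_addr.
(* The cut lies between two runs, since run counts add up; so [Cut] notices the end of the prefix
   exactly there. *)
have nojunc : ohead y != Some (last b x).
  have := runs_cat (b :: x) y; rewrite -sE -runsE /junction /=.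
  by rewrite lastI ohead_rev_rcons eq_sym; case: eqP => //=; lia.
have szt : size (take i (red s)) <= N.
  by apply: leq_trans hs; rewrite size_take_min geq_minr.
have [p pE] : exists p, take i (red s) = b :: p.
  by have := ohead_red (b :: x); rewrite ex; case: (take _ _) => //= c p [->]; exists p.
have step2 : cstep sorter (Gather (insub_bseq N (red s)), s, [::]) =
    Some ([::], (Cut (insub_bseq N (b :: p)), [::], s)).
  by rewrite /= val_insub // Ei pE cats0.
rewrite pE in ex szt.
have step3 : cstep sorter (Cut (insub_bseq N (b :: p)), [::], s) =
    Some ([::], (Cut (insub_bseq N (b :: p)), [:: b], x ++ y)).
  by rewrite sE /= val_insub //= eqxx.
have step4 : cstep sorter (Cut (insub_bseq N [:: last b x]), b :: x, y) =
    Some ([:: (size x).+1], (gather0, [::], rev (b :: x) ++ y)).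
  case: (y) nojunc => [|c y'] //= ne; rewrite val_insub; last exact: leq_trans szt.
  by rewrite /= eq_sym (negPf ne).
have r := crun_trans (run_gather_all hs) (crun_step step2 (crun_step step3
  (crun_trans (run_cut [:: b] y szt ex) (crun_step step4 (crun0 _ _))))).
by apply: crun_le r; rewrite sE /= size_cat; lia.
Qed.

(** Every round lowers the distance, so at most [d_s s] flips are made; at distance 0 the table has
    no entry and the controller halts after gathering. *)
Lemma exact_phase s : runs s <= N ->
  exists fl q u, [/\ sorter q None = Halt,
    crun sorter ((d_s s).+1 * (2 * size s + 3)) (gather0, [::], s) fl (q, u, [::]),
    valid_flips s fl, apply_flips fl s = I_sort s & size fl <= d_s s].
Proof.
have stop t : runs t <= N -> d_s t = 0 -> exists fl q u, [/\ sorter q None = Halt,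
    crun sorter ((d_s t).+1 * (2 * size t + 3)) (gather0, [::], t) fl (q, u, [::]),
    valid_flips t fl, apply_flips fl t = I_sort t & size fl <= d_s t].
  move=> ht d0; exists [::], (Gather (insub_bseq N (red t))), t; split=> //.
  - rewrite /= /best_flip val_insub //; case: pickP => // i /andP[_].
    by rewrite d_s_red d0.
  - by apply: crun_le (run_gather_all ht); lia.
  - by apply/I_sort_id; rewrite -d_s_eq0 d0.
move: {2}(d_s s) (leqnn (d_s s)) => n; elim: n s => [|n IH] s len hs.
  by apply: stop => //; apply/eqP; rewrite -leqn0.
have [d0|dpos] := posnP (d_s s); first exact: stop.
have [x [y [sE x0 lt hs' r]]] := exact_round hs dpos.
have fE : flip (size x) s = rev x ++ y by rewrite /flip sE take_size_cat ?drop_size_cat.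
have szE : size (rev x ++ y) = size s by rewrite -fE size_flip.
have [|fl [q [u [hq r' v e sz]]]] := IH (rev x ++ y) _ hs'.
  by rewrite -ltnS; apply: leq_trans lt len.
exists (size x :: fl), q, u; split=> //.
- by apply: crun_le (crun_trans r r'); rewrite szE -mulSn leq_mul2r ltnS lt orbT.
- rewrite /valid_flips /= -/(valid_flips s fl) -(valid_flips_flip s (size x)) fE v andbT.
  by rewrite lt0n size_eq0 x0 sE size_cat leq_addr.
- by rewrite /= fE e -fE I_sort_flip.
- exact: leq_ltn_trans sz lt.
Qed.

Lemma freeze_step F a q u y : q \in [:: InFirst F a; PastFirst F a] ->
    a \notin F -> all (mem F) y ->
  cstep sorter (q, u, y) = Some ([:: size u], (Greedy (a |: F), [::], rev u ++ y)).
Proof.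
rewrite !inE => hq aF; case: y => [|b y] /=; first by case/orP: hq => /eqP->.
case/andP=> bF _; have ne : (b == a) = false by apply: contraNF aF => /eqP<-.
by case/orP: hq => /eqP->; rewrite /= ne (bF : b \in F).
Qed.

Lemma run_past F a u v y : all [predC F] v -> a \notin F -> all (mem F) y ->
  exists z w G, [/\ v = z ++ w,
    crun sorter (size z).+1 (PastFirst F a, u, v ++ y) [:: size (u ++ z)]
      (Greedy G, [::], rev (u ++ z) ++ w ++ y),
    a \notin z & G = F /\ ohead w = Some a \/ G = a |: F /\ w = [::]].
Proof.
move=> + aF yF; elim: v u => [|b v IH] u /=.
  move=> _; exists [::], [::], (a |: F); split=> //; last by right.
  rewrite /= !cats0; apply: crun_last.
  by apply: freeze_step; rewrite // !inE eqxx orbT.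
case/andP=> bF vF; case: (eqVneq b a) => [ba|ne].
  exists [::], (b :: v), F; split=> //; last by left; rewrite /= ba.
  rewrite cats0; apply: crun_last.
  by rewrite /= ba eqxx.
have [z [w [G [-> r az hG]]]] := IH (rcons u b) vF.
exists (b :: z), w, G; split=> //; last by rewrite inE eq_sym negb_or ne.
rewrite -cat_rcons; apply: crun_silent r.
by rewrite /= (negPf ne) (negPf (bF : b \notin F)).
Qed.

(** A greedy round ends in one of two ways: [a] recurs after other symbols, where [z != [::]]
    separates the two runs to be merged, or the unfrozen part ends and [a] is frozen. *)
Lemma run_first F a u v y : all [predC F] v -> a \notin F -> all (mem F) y ->
  exists j z w G, [/\ v = nseq j a ++ z ++ w,
    crun sorter (size v).+1 (InFirst F a, u, v ++ y) [:: size (u ++ nseq j a ++ z)]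
      (Greedy G, [::], rev (u ++ nseq j a ++ z) ++ w ++ y),
    a \notin z & [/\ G = F, ohead w = Some a & z != [::]] \/ G = a |: F /\ w = [::]].
Proof.
move=> + aF yF; elim: v u => [|b v IH] u /=.
  move=> _; exists 0, [::], [::], (a |: F); split=> //; last by right.
  rewrite /= !cats0; apply: crun_last.
  by apply: freeze_step; rewrite // !inE eqxx.
case/andP=> bF vF; case: (eqVneq b a) => [->|ne].
  have [j [z [w [G [-> r az hG]]]]] := IH (rcons u a) vF.
  exists j.+1, z, w, G; split=> //.
  by rewrite /= -cat_rcons; apply: crun_silent r; rewrite /= eqxx.
have [z [w [G [-> r az hG]]]] := run_past (rcons u b) vF aF yF.
exists 0, (b :: z), w, G; split=> //.
- rewrite /= -cat_rcons; apply: crun_silent; last first.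
    by apply: crun_le r; rewrite size_cat; lia.
  by rewrite /= (negPf ne) (negPf (bF : b \notin F)).
- by rewrite inE eq_sym negb_or ne.
by case: hG => [[-> ->]|]; [left|right].
Qed.

(** The potential [runs (x ++ y) + (k - #|F|)] drops with every flip: a merging flip removes a run,
    a freezing flip enlarges [F] and creates no run. When no unfrozen symbol is left, the bound on
    [runs y] gives at most [k] runs. *)
Lemma greedy_phase n F x y :
    all [predC F] x -> all (mem F) y -> runs y <= #|F| -> runs (x ++ y) + (k - #|F|) <= n ->
  exists fl t, [/\ runs t <= k,
    crun sorter (n.+1 * (size (x ++ y) + 3)) (Greedy F, [::], x ++ y) fl (gather0, [::], t),
    valid_flips (x ++ y) fl, apply_flips fl (x ++ y) = t & size fl <= n].
Proof.
elim: n F x y => [|n IH] F [|a x] y xF yF ry len.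
1, 3: exists [::], y; split=> //;
      first by apply: leq_trans ry _; rewrite -[leqRHS](card_ord k) max_card.
1, 2: apply: (crun_le (B1 := 1)); first by rewrite mulSn; lia.
1, 2: apply: crun_last; case: (y) yF => [|b y'] //= /andP[bF _]; by rewrite (bF : b \in F).
  by move: len; rewrite /runs; case: (red _) (ohead_red ((a :: x) ++ y)).
move: xF => /= /andP[aF xF].
have [j [z [w [G [xE r az hG]]]]] := run_first [:: a] xF aF yF.
set u := a :: nseq j a ++ z.
have sE : (a :: x) ++ y = u ++ w ++ y by rewrite xE /u /= -!catA.
have fE : flip (size u) ((a :: x) ++ y) = rev u ++ w ++ y.
  by rewrite /flip sE take_size_cat ?drop_size_cat.
have vu : 0 < size u <= size ((a :: x) ++ y) by rewrite sE size_cat leq_addr.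
have {}r : crun sorter (size x + 2) (Greedy F, [::], (a :: x) ++ y) [:: size u]
    (Greedy G, [::], rev u ++ w ++ y).
  by rewrite addn2; apply: crun_silent r; rewrite /= (negPf aF).
have uF : all [predC F] u.
  by rewrite /u /= all_cat (aF : a \notin F); move: xF; rewrite xE !all_cat => /and3P[-> ->].
suff [x' [y' [E xG yG rG lG]]] : exists x' y', [/\ rev u ++ w ++ y = x' ++ y',
    all [predC G] x', all (mem G) y', runs y' <= #|G| & runs (x' ++ y') + (k - #|G|) <= n].
  have szE : size (x' ++ y') = size ((a :: x) ++ y) by rewrite -E -fE size_flip.
  have [fl [t [rt r' v e sz]]] := IH G x' y' xG yG rG lG.
  exists (size u :: fl), t; split=> //.
  - rewrite E in r; apply: crun_le (crun_trans r r').
    by rewrite szE (mulSn n.+1) leq_add2r /= size_cat; lia.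
  - apply/andP; split; first exact: vu.
    by move: v; rewrite -E -fE valid_flips_flip.
  - by rewrite [LHS]/= fE E.
case: hG => [[-> hw z0]|[-> w0]].
- exists (rev u ++ w), y; split=> //.
  + by rewrite catA.
  + rewrite all_cat all_rev uF; move: xF; rewrite xE !all_cat; by case/and3P.
  have m : (runs (rev u ++ (w ++ y))).+1 = runs (u ++ (w ++ y)).
    apply: runs_flip_merge => //; first by rewrite ohead_cat; case: (w) hw.
    rewrite /u rev_cons rev_cat -cats1 -catA !ohead_cat.
    case: (w) hw => // ? ? /= ->; case: (lastP z) z0 az => // z' c _.
    by rewrite mem_rcons inE negb_or eq_sym rev_rcons /= => /andP[ne _].
  by move: len; rewrite sE -m -catA addSn ltnS.
have uE : rev u = rev z ++ nseq j.+1 a.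
  by rewrite -[u]/(nseq j.+1 a ++ z) rev_cat rev_nseq.
have E : rev u ++ w ++ y = rev z ++ nseq j.+1 a ++ y by rewrite w0 uE -catA.
exists (rev z), (nseq j.+1 a ++ y); split=> //.
- rewrite all_rev; apply/allP => b bz /=; rewrite !inE negb_or.
  apply/andP; split; first by apply: contraNneq az => <-.
  by move/allP: xF; apply; rewrite xE !mem_cat bz orbT.
- rewrite all_cat all_nseq /= !inE eqxx /=.
  by apply: sub_all yF => b /= bF; rewrite !inE bF orbT.
- rewrite cardsU1 aF -[leqRHS]/(1 + #|F|) -(runs_nseq a j).
  by apply: leq_trans (leq_add (leqnn _) ry); rewrite -runs_cat leq_addr.
(* Ensures that the truncated difference [k - #|F|] really decreases. *)
have ck : #|a |: F| <= k by rewrite -[leqRHS](card_ord k) max_card.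
(* The last symbol of [u] is not frozen while [y] starts with a frozen one, so the flip destroys no
   fusion. *)
have ur : ohead (rev u) != ohead y.
  have [c [r' ru]] : exists c r', rev u = c :: r'.
    by rewrite uE; case: (rev z) => [|c r']; [exists a, (nseq j a)|exists c, (r' ++ nseq j.+1 a)].
  have cF : c \notin F by move: uF; rewrite -all_rev ru => /andP[].
  rewrite ru; case: (y) yF => [//|b y'] /= /andP[bF _].
  by apply: contraNneq cF => -[->].
have h := runs_flip_boundary ur.
rewrite -E w0 -ltnS; apply: leq_trans len; rewrite sE w0 -addnS; apply: leq_add h _.
by move: ck; rewrite cardsU1 aF add1n => ck; apply: ltn_sub2l.
Qed.

End Algorithm.

(** * The complete algorithm, its running time and the approximation ratio *)

Lemma I_sort_apply_flips k fl (s : seq 'I_k) : I_sort (apply_flips fl s) = I_sort s.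
Proof. by elim: fl s => //= i fl IH s; rewrite IH I_sort_flip. Qed.

Lemma size_apply_flips (T : Type) fl (s : seq T) : size (apply_flips fl s) = size s.
Proof. by elim: fl s => //= i fl IH s; rewrite IH size_flip. Qed.

Definition max_d_s k n := \max_(w : n.-bseq 'I_k) d_s w.

(** Contracting runs keeps the distance, so a maximum over finitely many short strings bounds it for
    strings of any length. *)
Lemma d_s_le_max k n (s : seq 'I_k) : runs s <= n -> d_s s <= max_d_s k n.
Proof.
move=> h; rewrite -d_s_red -(val_insub h).
exact: (leq_bigmax (insub_bseq n (red s))).
Qed.

Definition sorter_const k N := 3 * (max_d_s k N + max_d_s k k + k) + 10.

(** With more than [N] runs, the greedy phase leaves at most [k] of them; as [k <= N], the next
    gathering succeeds and the exact phase finishes. *)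
Lemma sorter_spec k N (s : seq 'I_k) : k <= N ->
  exists fl q u, [/\ sorter (N := N) q None = Halt,
    crun (sorter (N := N)) (sorter_const k N * (size s).+1 ^ 2) (gather0 k N, [::], s) fl (q, u, [::]),
    valid_flips s fl, apply_flips fl s = I_sort s
    & size fl <= if runs s <= N then d_s s else runs s + k + max_d_s k k].
Proof.
move=> kN; case: ifP => hs.
  have [fl [q [u [hq r v e sz]]]] := exact_phase hs.
  exists fl, q, u; split=> //; apply: crun_le r.
  have h := d_s_le_max hs; rewrite /sorter_const.
  apply: leq_trans (leq_mul (n2 := 3 * (size s).+1) (_ : _ <= (max_d_s k N).+1) _) _; rewrite ?ltnS //.
    by lia.
  by rewrite expnS expn1; nia.
have := @run_gather k N [::] s (leq0n _); rewrite /= hs.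
rewrite (_ : insub_bseq N (red [::]) = [bseq]); last by apply: val_inj; rewrite /= val_insub.
move=> r1.
have [||fl1 [t [rt r2 v1 e1 sz1]]] := @greedy_phase k N (runs s + k) set0 s [::] _ isT (leq0n _).
- by apply/allP => a _; rewrite /= inE.
- by rewrite cats0 cards0 subn0.
have [fl2 [q [u [hq r3 v2 e2 sz2]]]] := exact_phase (leq_trans rt kN).
rewrite cats0 in r2 v1 e1; have h := d_s_le_max rt.
have st : size t = size s by rewrite -e1 size_apply_flips.
exists (fl1 ++ fl2), q, u; split=> //.
- apply: crun_le (crun_trans r1 (crun_trans r2 r3)); rewrite st /sorter_const.
  have hr : (runs s + k).+1 * (size s + 3) <= (k.+1 * (size s).+1) * (3 * (size s).+1).
    apply: leq_mul; last by lia.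
    apply: (@leq_trans (size s + k).+1); last by nia.
    by rewrite ltnS leq_add2r; apply: size_subseq (subseq_red s).
  have hd : (d_s t).+1 * (2 * size s + 3) <= (max_d_s k k).+1 * (3 * (size s).+1).
    by apply: leq_mul; [exact: h | lia].
  apply: leq_trans (leq_add (leqnn _) (leq_add hr hd)) _.
  by rewrite expnS expn1; nia.
- by rewrite /valid_flips all_cat -/(valid_flips s fl1) v1 -st.
- by rewrite /apply_flips foldl_cat -/(apply_flips fl1 s) e1 -/(apply_flips fl2 t) e2 -e1 I_sort_apply_flips.
- by rewrite size_cat; apply: leq_add sz1 (leq_trans sz2 h).
Qed.

(** One number serves as coefficient and as exponent. The degree is 8: quadratically many controller
    steps use cubic space [S], and each costs time of order $S^2$. *)
Definition time_const K := 30 * K * (2 * K).+1 ^ 2 + (2 * K).+1 + 8.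

Lemma time_bound K n T : T <= K * n.+1 ^ 2 ->
  (let S := n + T * (2 * n).+1 in T * step_bound S + S) <= time_const K * n.+1 ^ time_const K.
Proof.
move=> hT; cbv zeta; set S := n + _; set m := n.+1 in hT *.
have hS : S.+1 <= (2 * K).+1 * m ^ 3.
  have : T * (2 * n).+1 <= K * m ^ 2 * (2 * m) by apply: leq_mul => //; rewrite /m; lia.
  have : m <= m ^ 3 by rewrite -{1}(expn1 m) leq_pexp2l.
  rewrite (expnS m 2) /S; have : n.+1 = m by []. nia.
have hb : step_bound S <= 30 * ((2 * K).+1 * m ^ 3) ^ 2.
  apply: (@leq_trans (30 * (S.+1 ^ 2))); last by rewrite leq_mul2l leq_exp2r.
  by rewrite /step_bound expnS expn1; nia.
have h8 : m ^ 3 <= m ^ 8 by rewrite leq_pexp2l.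
have hc : m ^ 8 <= m ^ time_const K by rewrite leq_pexp2l // /time_const; lia.
apply: (@leq_trans ((30 * K * (2 * K).+1 ^ 2 + (2 * K).+1) * m ^ 8)); last first.
  by apply: leq_mul => //; rewrite /time_const; lia.
rewrite mulnDl; apply: leq_add; last first.
  by apply: leq_trans (leqnSn S) (leq_trans hS _); rewrite leq_mul2l h8 orbT.
apply: leq_trans (leq_mul hT hb) _.
rewrite expnMn -expnM; apply: eq_leq.
by rewrite (expnD m 2 6); move: (m ^ 2) (m ^ 6) (_.+1 ^ 2) => a b c; nia.
Qed.

Local Open Scope ring_scope.

Theorem theorem4p8 (R : realType) (k : nat) (eps : R) :
  (2 <= k)%N -> 0 < eps ->
  exists M : TM, (k + 3 <= tm_nG M)%N /\
  exists c : nat, forall s : seq 'I_k,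
    exists fl : seq nat,
      tm_outputs M (c * (size s).+1 ^ c) s fl /\
      valid_flips s fl /\
      apply_flips fl s = I_sort s /\
      (size fl)%:R <= (1 + eps) * (d_s s)%:R.
Proof.
(* [C] is the additive excess of the greedy mode: [k] for freezing, [k] for the runs of a sorted
   string, and the final exact phase. The bound [n] makes it at most [eps * n]. *)
move=> _ eps0; pose C := (2 * k + max_d_s k k)%N; pose n := Num.bound (C%:R / eps).
have hn : C%:R <= eps * n%:R.
  rewrite mulrC -ler_pdivrMr //; apply/ltW/archi_boundP.
  by rewrite divr_ge0 // ltW.
(* More than [k + n] runs force [d_s s] to be at least [n], so the excess is at most
   [eps * d_s s]. *)
pose N := (k + n)%N.
exists (machine (gather0 k N) (sorter (N := N))); split=> /=; first by lia.
exists (time_const (sorter_const k N)) => s.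
have [fl [q [u [hq [T leT r] v e sz]]]] := sorter_spec s (leq_addr n k).
exists fl; split; first exact: machine_outputs r hq (time_bound leT).
split=> //; split=> //.
rewrite mulrDl mul1r; case: (leqP (runs s) (k + n)) sz => [_ sz|gt sz].
  apply: (@le_trans _ _ (d_s s)%:R); first by rewrite ler_nat.
  by rewrite lerDl; apply: mulr_ge0 => //; apply: ltW.
have h1 := runs_le_d_s s.
have h2 : (n <= d_s s)%N by move: gt; rewrite /N; lia.
have h3 : (size fl <= d_s s + C)%N by rewrite /C; lia.
apply: (@le_trans _ _ (d_s s + C)%:R); first by rewrite ler_nat.
rewrite natrD lerD2l; apply: le_trans hn _.
by rewrite ler_pM2l // ler_nat.
Qed.
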